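(* Let $\mu$ be a deletion distribution and suppose a core set algorithm $A$ can tolerate up to $K_{\mathrm{total}}$ deletions drawn from $\mu$ before exhausting the core set deletion capacity $K$. Then $$\mathbb E[\text{time per deletion}]\le\frac{K}{K_{\mathrm{total}}}\times\{\text{time per core set deletion}\}.$$
   Context: Core set algorithm: a learning algorithm $A$ with a map $\mathfrak C$ such that $\mathfrak C(S)\subseteq S$ and $A(S)=A(\mathfrak C(S))$ for every dataset $S$. Deletion requests are drawn without replacement from a dataset $S$ according to a probability weight vector $\mu$ over the points of $S$. A core set deletion is a request for a point of $\mathfrak C(S)$; the core set deletion capacity $K$ is the number of core set deletions the algorithm can process. ''Tolerates up to $K_{\mathrm{total}}$ deletions before exhausting $K$'' means that among the $K_{\mathrm{total}}$ deletion requests processed at most $K$ are core set deletions. At unlearning time the algorithm performs computation only for core set deletions (each taking the stated time per core set deletion); a deletion of a point outside the core set takes no computation time. The time per deletion is the unlearning time averaged over the $K_{\mathrm{total}}$ deletion requests. *)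

(* Defs.v *)
From HB Require Import structures.
From mathcomp Require Import all_boot all_order all_algebra.
From mathcomp Require Import finmap.
From mathcomp Require Import all_classical all_reals all_analysis.

Set Implicit Arguments.
Unset Strict Implicit.
Unset Printing Implicit Defensive.

Import Order.TTheory GRing.Theory Num.Theory.

Local Open Scope fset_scope.
Local Open Scope classical_set_scope.
Local Open Scope ring_scope.

(* [M] is the type of outputs of the learner; taking for [M] a type of
   distributions over hypotheses covers randomized learners. *)
Record core_set_algorithm (Z : choiceType) (M : Type) := CoreSetAlgorithm {
  learn : {fset Z} -> M;
  core_set : {fset Z} -> {fset Z};
  core_set_sub : forall S : {fset Z}, (core_set S `<=` S)%fset;
  learn_core_set : forall S : {fset Z}, learn S = learn (core_set S)
}.

Definition prob_weights (R : realType) (I : finType) (mu : I -> R) : Prop :=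
  (forall x, 0 <= mu x) /\ \sum_x mu x = 1.

(* Probability that successive draws without replacement from [I] according to
   the weights [mu] return [s]: the [i]-th draw picks a point not drawn before,
   with probability proportional to its weight among the remaining points. *)
Definition draw_prob (R : realType) (I : finType) (mu : I -> R) (n : nat)
    (s : 'I_n -> I) : R :=
  if injectiveb s then
    \prod_(i < n)
      (mu (s i) / \sum_(x | [forall j : 'I_n, (j < i)%N ==> (x != s j)]) mu x)
  else 0.

(* If [mu] charges fewer than [n] points then [draw_prob mu] vanishes on all
   sequences, and no family of [n] requests satisfies [draws_prob]. *)
Record drawn_without_replacement (R : realType) (d : measure_display)
    (T : measurableType d) (P : probability T R) (I : finType) (mu : I -> R)
    (n : nat) (X : 'I_n -> T -> I) : Prop := DrawnWithoutReplacement {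
  draws_measurable : forall i x, measurable (X i @^-1` [set x]);
  draws_prob : forall s : 'I_n -> I,
    P [set w | forall i, X i w = s i] = (draw_prob mu s)%:E
}.

Section CoreSetDeletions.
Variables (R : realType) (Z : choiceType) (M : Type).
Variables (A : core_set_algorithm Z M) (S : {fset Z}).

Definition core_set_deletion (z : S) : bool := fsval z \in core_set A S.

Definition num_core_set_deletions (n : nat) (s : 'I_n -> S) : nat :=
  #|[pred i | core_set_deletion (s i)]|.

Definition tolerates (d : measure_display) (T : measurableType d)
    (P : probability T R) (n : nat) (X : 'I_n -> T -> S) (K : nat) : Prop :=
  {ae P, forall w, (num_core_set_deletions (X^~ w) <= K)%N}.

Definition deletion_time (core_time : R) (z : S) : R :=
  if core_set_deletion z then core_time else 0.

Definition time_per_deletion (core_time : R) (n : nat) (s : 'I_n -> S) : R :=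
  (\sum_(i < n) deletion_time core_time (s i)) / n%:R.

End CoreSetDeletions.

(* Main.v *)
Require Import Defs.
From HB Require Import structures.
From mathcomp Require Import all_boot all_order all_algebra.
From mathcomp Require Import finmap.
From mathcomp Require Import all_classical all_reals all_analysis.
From mathcomp Require Import measurable_realfun.

Set Implicit Arguments.
Unset Strict Implicit.
Unset Printing Implicit Defensive.

Import Order.TTheory GRing.Theory Num.Theory.

Local Open Scope ring_scope.

(** Outside the core set a deletion is free, so along every request sequence the average time is
    exactly the fraction of core set deletions times [core_time] ([time_per_deletionE]). Almost
    surely at most [K] of the requests hit the core set, which bounds this average by a constant;
    integrating against a probability measure keeps the bound. *)

(** As [I] is finite, the preimage of any [B] is a finite union of fibres of [X]; hence [g] can be
    arbitrary and [I] needs no sigma-algebra. *)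
Lemma measurable_fun_finite_range (d d' : measure_display)
    (T : measurableType d) (U : measurableType d') (I : finType)
    (X : T -> I) (g : I -> U) :
  (forall x, measurable (X @^-1` [set x])%classic) ->
  measurable_fun [set: T]%classic (g \o X).
Proof.
move=> mX _ B _; rewrite setTI.
have -> : ((g \o X) @^-1` B = \bigcup_(x in g @^-1` B) X @^-1` [set x])%classic.
  by apply/seteqP; split=> [w Bw|w [x Bx /= Xwx]] /=; [exists (X w)|rewrite Xwx].
by apply: fin_bigcup_measurable => [|x _]; [exact: finite_finset|exact: mX].
Qed.

Lemma measurable_time_per_deletion (R : realType) (Z : choiceType) (M : Type)
    (A : core_set_algorithm Z M) (S : {fset Z}) (core_time : R) (n : nat)
    (d : measure_display) (T : measurableType d) (X : 'I_n -> T -> S) :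
  (forall i x, measurable (X i @^-1` [set x])%classic) ->
  measurable_fun [set: T]%classic
    (fun w => time_per_deletion A core_time (X^~ w)).
Proof.
move=> mX; apply: measurable_funM => //.
apply: measurable_sum => i.
exact: (measurable_fun_finite_range (deletion_time A core_time) (mX i)).
Qed.

Lemma time_per_deletionE (R : realType) (Z : choiceType) (M : Type)
    (A : core_set_algorithm Z M) (S : {fset Z}) (core_time : R) (n : nat)
    (s : 'I_n -> S) :
  time_per_deletion A core_time s =
    (num_core_set_deletions A s)%:R / n%:R * core_time.
Proof.
rewrite /time_per_deletion /deletion_time -big_mkcond sumr_const.
by rewrite mulrAC mulr_natl.
Qed.

Theorem theorem4p6 (R : realType) (Z : choiceType) (M : Type)
    (A : core_set_algorithm Z M) (S : {fset Z})
    (mu : S -> R) (mu_prob : prob_weights mu)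
    (Ktotal K : nat) (core_time : R) (core_time_ge0 : 0 <= core_time)
    (d : measure_display) (T : measurableType d) (P : probability T R)
    (X : 'I_Ktotal -> T -> S)
    (X_drawn : drawn_without_replacement P mu X)
    (A_tolerates : tolerates A P X K) :
  ('E_P[fun w => time_per_deletion A core_time (X^~ w)]
     <= (K%:R / Ktotal%:R * core_time)%:E)%E.
Proof.
rewrite unlock.
have mf := measurable_time_per_deletion A core_time (draws_measurable X_drawn).
(* Serves both integrands: [k] is the number of core set deletions for the time, and [K] for the
   bound. *)
have ge0 (k : nat) : 0 <= k%:R / Ktotal%:R * core_time.
  by rewrite mulr_ge0 // divr_ge0.
(* Since [P] has total mass 1, the bound is the integral of a constant, so an almost everywhere
   comparison of integrands suffices. *)
rewrite -[leRHS]mule1 -(probability_setT P) -integral_cst //.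
apply: ae_ge0_le_integral => //.
- by move=> w _; rewrite lee_fin time_per_deletionE.
- exact/measurable_EFinP.
- by move=> w _; rewrite lee_fin.
apply: filterS A_tolerates => w le_K _.
(* No case split on [Ktotal = 0]: the inverse of 0 is 0, still nonnegative. *)
by rewrite lee_fin time_per_deletionE !ler_wpM2r ?invr_ge0 ?ler_nat.
Qed.
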